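(* Let $n,m$ be positive integers with $m\le n$, and let $A\in\mathcal{T}(n,m)$, $A\neq0$, be $A=A_0+a_0I_{n\times m}$ with $A_0=A(a,\alpha)$, $a=(0,a_1,\dots,a_{n-1})^T$, $\alpha=(0,\alpha_1,\dots,\alpha_{m-1})^T$. Then $A$ is isometric (i.e. $A^*A=I_m$) if and only if $$A_0^{*}a+\overline{a}_0\,a^{\sharp}_{(n,m)}+a_0\alpha+\frac{|a_0|^2-\|a\|^2-1}{2}\,\varepsilon_0=0$$ and one of the following two cases holds: (1) $A$ is the asymmetric Toeplitz matrix with first column $(a_0,a_1,\dots,a_{n-m},0,\dots,0)^T$ and first row $(a_0,0,\dots,0)$ (that is, $\alpha=0$ and $a_i=0$ for $n-m+1\le i\le n-1$). (2) $A=A(a,\lambda\hat{a}_{(n,m)})+a_0I_{n\times m}$ (that is, $\alpha=\lambda\hat{a}_{(n,m)}$) for some $\lambda\in\mathbb{C}$ with $|\lambda|=1$.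
   Context: Matrices are complex; rows and columns of an $n\times m$ matrix are numbered $0,\dots,n-1$ and $0,\dots,m-1$. An asymmetric Toeplitz matrix is an $n\times m$ matrix constant along each diagonal; $\mathcal{T}(n,m)$ is the set of all of them. $A(a,\alpha)$ is the $n\times m$ matrix whose $(i,j)$ entry is $a_{i-j}$ if $i>j$, $0$ if $i=j$, and $\overline{\alpha}_{j-i}$ if $i<j$. $I_{n\times m}$ is the $n\times m$ matrix with $(i,j)$ entry $1$ if $i=j$ and $0$ otherwise, $I_m=I_{m\times m}$; every $A\in\mathcal{T}(n,m)$ is uniquely $A(a,\alpha)+a_0I_{n\times m}$. $\varepsilon_0=(1,0,\dots,0)^T\in\mathbb{C}^m$; $\|a\|^2=\sum_{i=1}^{n-1}|a_i|^2$. For $m\le n$: $a^{\sharp}_{(n,m)}=I_{m\times n}a=(0,a_1,\dots,a_{m-1})^T\in\mathbb{C}^m$ and $\hat{a}_{(n,m)}=(0,\overline{a}_{n-1},\dots,\overline{a}_{n-m+1})^T\in\mathbb{C}^m$. *)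

(* Defs.v *)
From HB Require Import structures.
From mathcomp Require Import all_boot all_order all_algebra.
From mathcomp Require Export complex.
From mathcomp Require Export reals.

Set Implicit Arguments.
Unset Strict Implicit.
Unset Printing Implicit Defensive.

Import Order.TTheory GRing.Theory Num.Theory.
Local Open Scope ring_scope.
Local Open Scope sesquilinear_scope.

Section AsymmetricToeplitz.
Variable C : numClosedFieldType.
Implicit Types n m : nat.

Definition is_toeplitz n m (A : 'M[C]_(n, m)) : Prop :=
  forall (i i' : 'I_n) (j j' : 'I_m),
    i%:Z - j%:Z = i'%:Z - j'%:Z -> A i j = A i' j'.

(* Indexing by [nat]. The default value 0 is only for [k >= n]; below, the
   index is always in range (in [hat], as soon as [0 < m <= n]). *)
Definition entry n (v : 'cV[C]_n) (k : nat) : C :=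
  if insub k is Some i then v i 0 else 0.

(* A(a, alpha); the 0-th entries of [a] and [alpha] are not used. *)
Definition toeplitz0 n m (a : 'cV[C]_n) (alpha : 'cV[C]_m) : 'M[C]_(n, m) :=
  \matrix_(i, j) if (j < i)%N then entry a (i - j)
                 else if (i < j)%N then (entry alpha (j - i))^*
                 else 0.

Definition rect_id n m : 'M[C]_(n, m) := \matrix_(i, j) (i == j :> nat)%:R.

(* First column [c], first row [r], assumed to agree at index 0; otherwise the
   diagonal comes from [c]. *)
Definition toeplitz_mx n m (c : 'cV[C]_n) (r : 'rV[C]_m) : 'M[C]_(n, m) :=
  \matrix_(i, j) if (j <= i)%N then entry c (i - j) else entry r^T (j - i).

Definition isometric n m (A : 'M[C]_(n, m)) : Prop :=
  A^t* *m A = 1%:M.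

Definition eps0 m : 'cV[C]_m := \col_i (i == 0%N :> nat)%:R.

Definition sqnorm n (a : 'cV[C]_n) : C :=
  \sum_(i < n | (0 < i)%N) `|a i 0| ^+ 2.

Definition sharp n m (a : 'cV[C]_n) : 'cV[C]_m := rect_id m n *m a.

Definition hat n m (a : 'cV[C]_n) : 'cV[C]_m :=
  \col_k if k == 0%N :> nat then 0 else (entry a (n - k))^*.

End AsymmetricToeplitz.

(* Main.v *)
Require Import Defs.
From mathcomp Require Import all_boot all_order all_algebra.
From mathcomp Require Import complex reals.
From mathcomp Require Import ring zify.

(** Write the entries of the Toeplitz matrix [A] as [A i j = t (i - j)].  The
    entries of [A^* A] are [G j k = \sum_(i < n) (t (i - j))^* * t (i - k)], and
    shifting the summation index by one changes only the two end terms: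
      [G j.+1 k.+1 + (t (n - j.+1))^* * t (n - k.+1)
         = (t (- j.+1))^* * t (- k.+1) + G j k]
    ([gramSS]).  Hence [G] is the identity if and only if its first column is
    [eps0] and the end terms cancel for all [0 < j, k < m] ([gram_orthonormal]).

    The first column of [G] is [A^* (a + a0 eps0)], which expands to
    [A0^* a + a0^* sharp a + a0 alpha + |a0|^2 eps0]; its entry of index 0 is
    [|a0|^2 + ||a||^2].  Equating it to [eps0] forces [|a0|^2 + ||a||^2 = 1], and
    so amounts to the equation of the theorem ([first_col_eq]).

    Since [(t (- j))^* = alpha j] and [(t (n - j))^* = hat a j] for [0 < j < m],
    the cancellation of the end terms says that the rank-one matrices
    [alpha alpha^*] and [hat a (hat a)^*] coincide, that is, that
    [alpha = lambda hat a] with [|lambda| = 1] ([rank1_eq]).  This is case (2);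
    case (1) is its instance [alpha = hat a = 0] ([hat_multiple_cases]). *)

Set Implicit Arguments.
Unset Strict Implicit.
Unset Printing Implicit Defensive.

Import Order.TTheory GRing.Theory Num.Theory.
Local Open Scope ring_scope.
Local Open Scope sesquilinear_scope.

Section ToeplitzIsometries.
Variable C : numClosedFieldType.
Implicit Types (t : int -> C) (n m : nat).

(** * Gram matrices of Toeplitz matrices *)

(** The inner product of the columns [j] and [k] of the Toeplitz matrix with [n]
    rows whose [(i, j)] entry is [t (i - j)]; the indices [j] and [k] are
    unbounded, as the number of columns plays no role. *)
Definition gram t n j k : C :=
  \sum_(i < n) (t (i%:Z - j%:Z))^* * t (i%:Z - k%:Z).

Lemma gramC t n j k : (gram t n j k)^* = gram t n k j.
Proof.
by rewrite rmorph_sum; apply: eq_bigr => i _; rewrite rmorphM /= conjCK mulrC.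
Qed.

(** The sums for [(j.+1, k.+1)] and [(j, k)] are over two windows of length [n]
    that differ by a shift of one; the identity avoids subtraction. *)
Lemma gramSS t n j k :
  gram t n j.+1 k.+1 + (t (n%:Z - j.+1%:Z))^* * t (n%:Z - k.+1%:Z) =
  (t (- j.+1%:Z))^* * t (- k.+1%:Z) + gram t n j k.
Proof.
have -> : (t (n%:Z - j.+1%:Z))^* * t (n%:Z - k.+1%:Z) =
  \sum_(n <= i < n.+1) (t (i%:Z - j.+1%:Z))^* * t (i%:Z - k.+1%:Z).
  by rewrite big_nat1.
rewrite /gram -(big_mkord xpredT
  (fun i => (t (i%:Z - j.+1%:Z))^* * t (i%:Z - k.+1%:Z))).
rewrite -big_cat_nat //= big_nat_recl // !sub0r big_mkord.
congr (_ + _); apply: eq_bigr => i _.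
by congr ((t _)^* * t _); lia.
Qed.

(** The Gram matrix is the identity as soon as its first column is that of the
    identity and it is constant along diagonals; Hermitian symmetry gives its
    first row. *)
Lemma gram_orthonormal t n m :
  (forall j k, (j < m)%N -> (k < m)%N -> gram t n j k = (j == k)%:R) <->
  (forall j, (j < m)%N -> gram t n j 0 = (j == 0)%:R) /\
  (forall j k, (0 < j < m)%N -> (0 < k < m)%N ->
     (t (- j%:Z))^* * t (- k%:Z) = (t (n%:Z - j%:Z))^* * t (n%:Z - k%:Z)).
Proof.
split=> [G1 | [G0 tE]].
  split=> [j jm | [//|j] [//|k] /andP[_ jm] /andP[_ km]].
    by apply: G1 => //; lia.
  have := gramSS t n j k.
  rewrite !G1 ?(ltnW jm) ?(ltnW km) // eqSS [RHS]addrC.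
  by move/addrI.
elim=> [|j IHj] [|k] jm km; first exact: G0.
- by rewrite -gramC G0 // rmorph_nat.
- by rewrite G0.
have := gramSS t n j k; rewrite tE ?jm ?km // addrC => /addrI ->.
by rewrite IHj // ltnW.
Qed.

(** * Equality of rank-one Hermitian matrices *)

(** A vector [u] is determined by [u u^*] up to a unimodular factor. *)
Lemma rank1_eq m (u v : 'cV[C]_m) :
  (forall j k, u j 0 * (u k 0)^* = v j 0 * (v k 0)^*) <->
  exists l : C, `|l| = 1 /\ u = l *: v.
Proof.
split=> [uv | [l [l1 ->]] j k]; last first.
  rewrite !mxE rmorphM mulrACA.
  by rewrite -normCK l1 expr1n mul1r.
have nuv k : `|u k 0| = `|v k 0|.
  by apply/eqP; rewrite -(@eqrXn2 C 2) ?normr_ge0 // !normCK uv.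
have [v0 | /eqP v0] := eqVneq v 0.
  exists 1; rewrite normr1 scale1r v0; split=> //.
  apply/colP => k; apply/eqP.
  by rewrite mxE -normr_eq0 nuv v0 mxE normr0.
have [k vk] : exists k, v k 0 != 0.
  apply/existsP; apply: contra_notT v0 => /existsPn v0.
  by apply/colP => k; rewrite mxE; apply/eqP/negPn/v0.
have uk : u k 0 != 0 by rewrite -normr_eq0 nuv normr_eq0.
have vkc : (v k 0)^* != 0 by rewrite conjC_eq0.
have ukc : (u k 0)^* != 0 by rewrite conjC_eq0.
(* The equation for [(j, k)] reads [u j = v j * (v k / u k)^*], and the factor
   is [u k / v k] because [|u k| = |v k|]. *)
exists (u k 0 / v k 0); split.
  by rewrite normf_div nuv divff // normr_eq0.
apply/colP => j; rewrite mxE; apply: (mulIf ukc); rewrite uv.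
have -> : u k 0 / v k 0 * v j 0 * (u k 0)^* =
  (u k 0 * (u k 0)^*) * v j 0 / v k 0 by ring.
by rewrite uv; field.
Qed.

(** * The diagonals of a Toeplitz matrix *)

(** The sequence of diagonals of [A(a, alpha) + a0 I]: index [k > 0] is the
    [k]-th diagonal below the main one. As [Negz k] is [- k.+1], the index of
    [alpha] is shifted. *)
Definition symbol n m (a0 : C) (a : 'cV[C]_n) (alpha : 'cV[C]_m) (z : int) : C :=
  match z with
  | Posz 0 => a0
  | Posz k => entry a k
  | Negz k => (entry alpha k.+1)^*
  end.

Lemma entry_ord n (v : 'cV[C]_n) (i : 'I_n) : entry v i = v i 0.
Proof. by rewrite /entry valK. Qed.

Lemma entryZ n l (v : 'cV[C]_n) k : entry (l *: v) k = l * entry v k.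
Proof. by rewrite /entry; case: insub => [i|]; rewrite ?mxE ?mulr0. Qed.

Lemma toeplitz_symbolE n m (a0 : C) (a : 'cV[C]_n) (alpha : 'cV[C]_m) i j :
  (toeplitz0 a alpha + a0 *: rect_id C n m) i j =
  symbol a0 a alpha (i%:Z - j%:Z).
Proof.
rewrite !mxE; case: ltngtP => [ji|ij|->].
- have -> : i%:Z - j%:Z = Posz (i - j).-1.+1 by lia.
  by rewrite /= prednK ?subn_gt0 // mulr0 addr0.
- have -> : i%:Z - j%:Z = Negz (j - i).-1 by lia.
  by rewrite /= prednK ?subn_gt0 // mulr0 addr0.
- by rewrite subrr /= mulr1 add0r.
Qed.

Lemma isometric_gram n m (A : 'M[C]_(n, m)) t :
  (forall i j, A i j = t (i%:Z - j%:Z)) ->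
  isometric A <->
  forall j k, (j < m)%N -> (k < m)%N -> gram t n j k = (j == k)%:R.
Proof.
move=> At; have GE j k : (A^t* *m A) j k = gram t n j k.
  by rewrite mxE; apply: eq_bigr => i _; rewrite !mxE !At.
split=> [A1 j k jm km | G1].
  by rewrite -(GE (Ordinal jm) (Ordinal km)) A1 mxE.
by apply/matrixP => j k; rewrite GE G1 // mxE.
Qed.

(** * The first column of the Gram matrix *)

(** The vector of inner products with the first column, which is
    [a + a0 *: eps0]. *)
Lemma first_col_gram n m (a0 : C) (a : 'cV[C]_n.+1) (alpha : 'cV[C]_m.+1)
    (ha : entry a 0 = 0) (halpha : entry alpha 0 = 0) :
  let t := symbol a0 a alpha in
  \col_(j < m.+1) gram t n.+1 j 0 =
  (toeplitz0 a alpha)^t* *m a + a0^* *: sharp m.+1 a + a0 *: alpha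
    + `|a0| ^+ 2 *: eps0 C m.+1.
Proof.
move=> t; apply/colP => j; rewrite [LHS]mxE.
have a00 : a 0 0 = 0 by rewrite -entry_ord.
have al0 : alpha 0 0 = 0 by rewrite -entry_ord.
have colE (i : 'I_n.+1) : t (i%:Z - 0%:Z) = a i 0 + a0 * (i == 0)%:R.
  rewrite subr0; have [-> | i0] := eqVneq i 0; first by rewrite a00 mulr1 add0r.
  by rewrite -entry_ord mulr0 addr0; case: i i0 => [[|i]].
have rowE : (t (0%:Z - j%:Z))^* = alpha j 0 + a0^* * (j == 0)%:R.
  rewrite sub0r; have [-> | j0] := eqVneq j 0; first by rewrite al0 mulr1 add0r.
  rewrite -entry_ord mulr0 addr0; case: j j0 => [[|j]] //= _ _.
  by rewrite conjCK.
have -> : gram t n.+1 j 0 =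
    \sum_(i < n.+1) (t (i%:Z - j%:Z))^* * a i 0 + (t (0%:Z - j%:Z))^* * a0.
  rewrite /gram (eq_bigr (fun i : 'I_n.+1 => (t (i%:Z - j%:Z))^* * a i 0
    + (t (i%:Z - j%:Z))^* * (a0 * (i == 0)%:R))); last first.
    by move=> i _; rewrite colE mulrDr.
  rewrite big_split /= [X in _ + X](bigD1 ord0) //= mulr1.
  by rewrite [X in _ + (_ + X)]big1 ?addr0 // => i /negPf->; rewrite !mulr0.
have -> : \sum_(i < n.+1) (t (i%:Z - j%:Z))^* * a i 0 =
    ((toeplitz0 a alpha)^t* *m a + a0^* *: sharp m.+1 a) j 0.
  rewrite !mxE mulr_sumr -big_split /=; apply: eq_bigr => i _.
  rewrite /t -toeplitz_symbolE !mxE rmorphD rmorphM rmorph_nat mulrDl mulrA.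
  by rewrite [j == i :> nat]eq_sym.
rewrite rowE [RHS]mxE [X in _ = X + _]mxE -addrA; congr (_ + _).
by rewrite !mxE normCK; ring.
Qed.

Lemma gram00 n m (a0 : C) (a : 'cV[C]_n.+1) (alpha : 'cV[C]_m) :
  gram (symbol a0 a alpha) n.+1 0 0 = `|a0| ^+ 2 + sqnorm a.
Proof.
rewrite /gram /sqnorm (bigD1 ord0) //= normCKC; congr (_ + _).
apply: eq_big => [i | i i0]; first by rewrite lt0n.
rewrite addn0 normCKC -entry_ord.
by case: i i0 => [[|i]].
Qed.

(** The vector equation of the theorem says that the first column is a unit
    vector orthogonal to the others. *)
Lemma first_col_eq n m (a0 : C) (a : 'cV[C]_n.+1) (alpha : 'cV[C]_m.+1)
    (ha : entry a 0 = 0) (halpha : entry alpha 0 = 0) :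
  (toeplitz0 a alpha)^t* *m a + a0^* *: sharp m.+1 a + a0 *: alpha
    + ((`|a0| ^+ 2 - sqnorm a - 1) / 2) *: eps0 C m.+1 = 0 <->
  forall j, (j < m.+1)%N ->
    gram (symbol a0 a alpha) n.+1 j 0 = (j == 0)%:R.
Proof.
set t := symbol a0 a alpha; set s := _ / 2.
have := first_col_gram a0 ha halpha; rewrite /= -/t.
set w := _ + a0 *: alpha; move=> GE.
have G00 : gram t n.+1 0 0 = `|a0| ^+ 2 + sqnorm a by exact: gram00.
(* The left-hand side is the first Gram column minus [c *: eps0] with
   [c = (1 + `|a0| ^+ 2 + sqnorm a) / 2], and [c = 1] when the first column has
   norm 1. *)
have wE (j : 'I_m.+1) :
    (w + s *: eps0 C m.+1) j 0 = gram t n.+1 j 0 -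
    ((1 + (`|a0| ^+ 2 + sqnorm a)) / 2) * (j == 0%N :> nat)%:R.
  have := congr1 (fun v : 'cV_m.+1 => v j 0) GE; rewrite !mxE => ->.
  by rewrite /s; field.
split=> [w0 j jm | G0]; last first.
  apply/colP => j; rewrite wE mxE G0 //.
  have := G0 0%N isT; rewrite G00 /= => s1.
  by rewrite s1; field.
(* At index 0 the equation reads [x = (1 + x) / 2] for the squared norm [x] of
   the first column. *)
have w0j i := etrans (esym (wE i)) (congr1 (fun v : 'cV_m.+1 => v i 0) w0).
have s1 : `|a0| ^+ 2 + sqnorm a = 1.
  have := w0j 0; rewrite mxE G00 eqxx mulr1 => /eqP; rewrite subr_eq0 => /eqP E.
  transitivity (2 * (`|a0| ^+ 2 + sqnorm a) - (`|a0| ^+ 2 + sqnorm a)).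
    by ring.
  by rewrite {1}E; field.
have := w0j (Ordinal jm); rewrite mxE s1 /= => /eqP.
rewrite subr_eq0 => /eqP ->.
by rewrite divff ?mul1r // -[1 + 1]/(2%:R) pnatr_eq0.
Qed.

(** * The end terms and the two cases *)

Lemma symbolN n m (a0 : C) (a : 'cV[C]_n) (alpha : 'cV[C]_m) k :
  (0 < k)%N -> symbol a0 a alpha (- k%:Z) = (entry alpha k)^*.
Proof. by case: k. Qed.

Lemma entry_hat0 n m (a : 'cV[C]_n) : entry (hat m a) 0 = 0.
Proof. by rewrite /entry; case: insubP => // i _ i0; rewrite mxE i0. Qed.

Lemma symbol_hat n m (a0 : C) (a : 'cV[C]_n) (alpha : 'cV[C]_m) k :
    (m <= n)%N -> (0 < k < m)%N ->
  symbol a0 a alpha (n%:Z - k%:Z) = (entry (hat m a) k)^*.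
Proof.
move=> mn /andP[k0 km]; have kn : (k < n)%N by apply: leq_trans mn.
rewrite -[k in RHS]/(val (Ordinal km)) entry_ord mxE /= gtn_eqF // conjCK.
rewrite subzn ?(ltnW kn) //.
by have -> : (n - k)%N = (n - k).-1.+1 by lia.
Qed.

(** The two end terms of the shift identity are the entries of the rank-one
    matrices built on [alpha] and on [hat m a]. *)
Lemma end_terms_eq n m (a0 : C) (a : 'cV[C]_n) (alpha : 'cV[C]_m) :
    (m <= n)%N -> entry alpha 0 = 0 ->
  let t := symbol a0 a alpha in
  (forall j k, (0 < j < m)%N -> (0 < k < m)%N ->
     (t (- j%:Z))^* * t (- k%:Z) = (t (n%:Z - j%:Z))^* * t (n%:Z - k%:Z)) <->
  exists l : C, `|l| = 1 /\ alpha = l *: hat m a.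
Proof.
move=> mn halpha t; rewrite -rank1_eq.
have tN k : (0 < k < m)%N -> t (- k%:Z) = (entry alpha k)^*.
  by case/andP=> k0 _; exact: symbolN.
have tB k : (0 < k < m)%N -> t (n%:Z - k%:Z) = (entry (hat m a) k)^*.
  exact: symbol_hat.
split=> [tE j k | uE j k jm km]; last first.
  rewrite !tN // !tB // !conjCK.
  case/andP: jm => _ jm; case/andP: km => _ km.
  by have := uE (Ordinal jm) (Ordinal km); rewrite -!entry_ord.
rewrite -!entry_ord.
have [-> | j0] := posnP j; first by rewrite halpha entry_hat0 !mul0r.
have [-> | k0] := posnP k; first by rewrite halpha entry_hat0 conjC0 !mulr0.
have jm : (0 < j < m)%N by rewrite j0 /=.
have km : (0 < k < m)%N by rewrite k0 /=.
by have := tE j k jm km; rewrite !tN // !tB // !conjCK.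
Qed.

(** In case (1) the first row and the end of the first column vanish, so that
    [alpha = hat m a = 0] and [l = 1] serves. *)
Lemma hat_multiple_cases n m (a0 : C) (a : 'cV[C]_n.+1) (alpha : 'cV[C]_m.+1)
    (A := toeplitz0 a alpha + a0 *: rect_id C n.+1 m.+1) :
    (m.+1 <= n.+1)%N -> entry alpha 0 = 0 ->
  (exists l : C, `|l| = 1 /\ alpha = l *: hat m.+1 a) <->
  (A = toeplitz_mx
         (\col_(i < n.+1) if i == 0%N :> nat then a0
                          else if (i <= n.+1 - m.+1)%N then a i 0 else 0)
         (\row_(j < m.+1) if j == 0%N :> nat then a0 else 0)
   \/ exists l : C, `|l| = 1 /\
        A = toeplitz0 a (l *: hat m.+1 a) + a0 *: rect_id C n.+1 m.+1).
Proof.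
move=> mn halpha.
have AE i j : A i j = symbol a0 a alpha (i%:Z - j%:Z).
  exact: toeplitz_symbolE.
split=> [[l [l1 alE]] | [A1 | [l [l1 A2]]]].
- by right; exists l; rewrite -alE.
- exists 1; split; first exact: normr1.
  apply/colP => k; rewrite scale1r -!entry_ord.
  have [-> | k0] := posnP k; first by rewrite halpha entry_hat0.
  have km : (0 < k < m.+1)%N by rewrite k0 /=.
  have kn : (k <= n.+1)%N by apply: leq_trans (ltnW (ltn_ord k)) mn.
  apply: (inv_inj conjCK).
  rewrite -(symbolN a0 a alpha k0) -(symbol_hat a0 a alpha mn km).
  have in_n : (n.+1 - k < n.+1)%N by lia.
  have := AE 0 k; have := AE (Ordinal in_n) 0.
  rewrite subr0 sub0r subzn // => <- <-.
  rewrite A1 !mxE /= leqNgt k0 subn0.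
  have -> : (n.+1 - k)%N = Ordinal in_n by [].
  rewrite subn0 -[(k : nat)]/(val k) !entry_ord !mxE /=.
  (* [n.+1 - k] exceeds [n - m] because [k <= m]. *)
  by rewrite !ifF //; apply/negbTE; lia.
- exists l; split=> //; apply/colP => k; rewrite -!entry_ord.
  have [-> | k0] := posnP k; first by rewrite halpha entryZ entry_hat0 mulr0.
  apply: (inv_inj conjCK).
  by have := AE 0 k; rewrite A2 toeplitz_symbolE sub0r !symbolN.
Qed.

End ToeplitzIsometries.

(** * The characterization of isometries *)

Theorem theorem4p2 (R : realType) (n m : nat)
  (hn : (0 < n)%N) (hm : (0 < m)%N) (hmn : (m <= n)%N)
  (A : 'M[R[i]]_(n, m)) (hA : is_toeplitz A) (hA0 : A <> 0)
  (a0 : R[i]) (a : 'cV[R[i]]_n) (alpha : 'cV[R[i]]_m)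
  (ha : entry a 0 = 0) (halpha : entry alpha 0 = 0)
  (hdec : A = toeplitz0 a alpha + a0 *: rect_id _ n m) :
  isometric A <->
    (toeplitz0 a alpha)^t* *m a
      + a0^* *: sharp m a + a0 *: alpha
      + ((`|a0| ^+ 2 - sqnorm a - 1) / 2) *: eps0 _ m = 0
    /\ (A = toeplitz_mx
              (\col_(i < n) if i == 0%N :> nat then a0
                            else if (i <= n - m)%N then a i 0 else 0)
              (\row_(j < m) if j == 0%N :> nat then a0 else 0)
        \/ exists lambda : R[i], `|lambda| = 1 /\
             A = toeplitz0 a (lambda *: hat m a) + a0 *: rect_id _ n m).
Proof.
have AE i j : A i j = symbol a0 a alpha (i%:Z - j%:Z).
  by rewrite hdec toeplitz_symbolE.
rewrite (isometric_gram AE) gram_orthonormal (end_terms_eq a0 a hmn halpha).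
rewrite {A hA hA0 AE}hdec.
case: n m hn hm hmn a alpha ha halpha => [//|n] [//|m] _ _ mn a alpha ha halpha.
by rewrite first_col_eq // (hat_multiple_cases a0 a mn halpha).
Qed.
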